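(* Let $\Delta T$, $\Delta t$, $\delta t$ and $\alpha>0$ be fixed, with $0<\delta t\le \Delta t\le \Delta T$. For $\sigma<0$ let $\rho(\sigma)$ denote the spectral radius of the matrix $I-A_{\Delta t}^{-1}A_{\delta t}$ (which depends on $\sigma$), for an arbitrary number of sub-intervals $L\ge 1$. Then $$\max_{\sigma<0}\rho(\sigma)\le \frac{0.79\,\Delta t}{\alpha+\sqrt{\alpha\Delta t}}+0.3 ,$$ that is, $\rho(\sigma)$ is bounded by the right-hand side for all $\sigma<0$. Thus, if $\alpha>0.4544\,\Delta t$, then the linear ParaOpt algorithm $$X^{k+1}=\left(I-A_{\Delta t}^{-1}A_{\delta t}\right)X^{k}+A_{\Delta t}^{-1}b,\qquad k=0,1,2,\ldots$$ converges.
   Context: Setting: the control problem for the scalar equation $\dot y=\sigma y+c$ on $[0,T]$, with $\sigma$ real and negative, is discretized by implicit Euler. Here $T=L\Delta T$, with $L\ge1$ an integer number of sub-intervals; $\Delta T=N\delta t$ with $N$ a positive integer; $\delta t$ is the fine and $\Delta t$ the coarse time step, $0<\delta t\le\Delta t\le\Delta T$; $\alpha>0$ is a regularization parameter. For $\tau\in\{\delta t,\Delta t\}$ define $$\beta_\tau=(1-\sigma\tau)^{-\Delta T/\tau},\qquad \gamma_\tau=\frac{\beta_\tau^2-1}{\sigma(2-\sigma\tau)}.$$ $A_\tau$ is the $(2L+1)\times(2L+1)$ real matrix acting on $X=(Y_0,Y_1,\ldots,Y_L,\Lambda_1,\ldots,\Lambda_L)^T$ whose product $A_\tau X$ has, in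 order, the components: - $Y_0$; - $-\beta_\tau Y_{\ell-1}+Y_\ell+\frac{\gamma_\tau}{\alpha}\Lambda_\ell$ for $\ell=1,\ldots,L$; - $\Lambda_\ell-\beta_\tau\Lambda_{\ell+1}$ for $\ell=1,\ldots,L-1$; - $-Y_L+\Lambda_L$. The right-hand side is $b=(y_{init},0,\ldots,0,-y_{target})^T\in\mathbb{R}^{2L+1}$, where $y_{init},y_{target}\in\mathbb{R}$ are given. The algorithm ''converges'' means that $X^k$ converges, from any initial $X^0$, to the solution of $A_{\delta t}X=b$. *)

(* Defs.v *)
From HB Require Import structures.
From mathcomp Require Import all_boot all_order all_algebra.
From mathcomp Require Import all_classical all_reals all_analysis.
From mathcomp Require Import complex.
From mathcomp Require Import ring lra zify.
Set Implicit Arguments.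
Unset Strict Implicit.
Unset Printing Implicit Defensive.
Import Order.TTheory GRing.Theory Num.Theory.
Import numFieldNormedType.Exports.
Local Open Scope classical_set_scope.
Local Open Scope ring_scope.

(* The supremum is a maximum as soon as [0 < n]: the spectrum, taken over the
   complex numbers, is then finite and nonempty. *)
Definition spectral_radius (R : realType) (n : nat) (M : 'M[R]_n) : R :=
  sup [set Normc.normc z | z in
         [set z : R[i] | eigenvalue (map_mx (real_complex R) M) z]].

(* [DT / tau] need not be an integer, hence the real power. *)
Definition beta (R : realType) (sigma DT tau : R) : R :=
  (1 - sigma * tau) `^ (- (DT / tau)).

Definition gamma (R : realType) (sigma DT tau : R) : R :=
  (beta sigma DT tau ^+ 2 - 1) / (sigma * (2 - sigma * tau)).

(* The unknown is (Y_0, ..., Y_L, Lambda_1, ..., Lambda_L): the first block has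
   indices l = 0, ..., L and index i : 'I_L of the second block stands for
   Lambda_(i+1). The product with a vector is spelled out in
   [paraopt_mx_mulE]. *)
Definition paraopt_mx (R : realType) (L : nat) (alpha sigma DT tau : R) :
    'M[R]_(L.+1 + L) :=
  block_mx
    (\matrix_(i < L.+1, j < L.+1)
       ((i == j)%:R - beta sigma DT tau * (i == j.+1 :> nat)%:R))
    (\matrix_(i < L.+1, j < L)
       (gamma sigma DT tau / alpha * (i == j.+1 :> nat)%:R))
    (\matrix_(i < L, j < L.+1) (- ((i.+1 == L) && (j == L :> nat))%:R))
    (\matrix_(i < L, j < L)
       ((i == j)%:R - beta sigma DT tau * (j == i.+1 :> nat)%:R)).

Definition paraopt_rhs (R : realType) (L : nat) (yinit ytarget : R) :
    'cV[R]_(L.+1 + L) :=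
  col_mx (\col_(i < L.+1) (if i == 0%N :> nat then yinit else 0))
         (\col_(i < L) (if i.+1 == L then - ytarget else 0)).

Definition paraopt_iter_mx (R : realType) (L : nat)
    (alpha sigma DT Dt dt : R) : 'M[R]_(L.+1 + L) :=
  1%:M - invmx (paraopt_mx L alpha sigma DT Dt)
         *m paraopt_mx L alpha sigma DT dt.

Definition paraopt_seq (R : realType) (L : nat)
    (alpha sigma DT Dt dt yinit ytarget : R) (X0 : 'cV[R]_(L.+1 + L))
    (k : nat) : 'cV[R]_(L.+1 + L) :=
  iter k (fun X => paraopt_iter_mx L alpha sigma DT Dt dt *m X
      + invmx (paraopt_mx L alpha sigma DT Dt) *m paraopt_rhs L yinit ytarget)
    X0.

Definition paraopt_converges (R : realType) (L : nat)
    (alpha sigma DT Dt dt yinit ytarget : R) : Prop :=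
  exists X : 'cV[R]_(L.+1 + L),
    [/\ paraopt_mx L alpha sigma DT dt *m X = paraopt_rhs L yinit ytarget,
        forall Z, paraopt_mx L alpha sigma DT dt *m Z
                    = paraopt_rhs L yinit ytarget -> Z = X
      & forall X0 : 'cV[R]_(L.+1 + L),
          paraopt_seq alpha sigma DT Dt dt yinit ytarget X0 @ \oo --> X].

Lemma paraopt_mx_mulE (R : realType) (L : nat) (alpha sigma DT tau : R)
    (y lam : nat -> R) :
  paraopt_mx L alpha sigma DT tau
    *m col_mx (\col_(i < L.+1) y i) (\col_(i < L) lam i.+1)
  = col_mx
      (\col_(l < L.+1)
         (if l == 0%N :> nat then y 0%N
          else - beta sigma DT tau * y l.-1 + y l
               + gamma sigma DT tau / alpha * lam l))
      (\col_(i < L)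
         (if i.+1 == L then - y L + lam L
          else lam i.+1 - beta sigma DT tau * lam i.+2)).
Proof.
have sumE (n : nat) (f : nat -> R) (m : nat) :
    \sum_(j < n) f j * (m == j :> nat)%:R = if (m < n)%N then f m else 0.
  case: ltnP => mn.
    rewrite (bigD1 (Ordinal mn)) //= eqxx mulr1 big1 ?addr0 // => j jm.
    by rewrite (_ : (m == j) = false) ?mulr0 // eq_sym; apply/negbTE.
  rewrite big1 // => j _; rewrite (_ : (m == j) = false) ?mulr0 //.
  by apply/negbTE; rewrite neq_ltn (leq_trans (ltn_ord j) mn) orbT.
rewrite /paraopt_mx mul_block_col; congr col_mx; apply/colP => i;
  rewrite !mxE; under eq_bigr do rewrite !mxE;
  under [X in _ + X]eq_bigr do rewrite !mxE.
- case: i => -[|i] iL /=.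
    rewrite [X in _ + X]big1 ?addr0 => [|j _]; last by rewrite mulr0 mul0r.
    rewrite (eq_bigr (fun j : 'I__ => y j * (0%N == j :> nat)%:R)) ?sumE // => j _.
    by rewrite mulr0 subr0 mulrC.
  rewrite (eq_bigr (fun j : 'I__ => y j * (i.+1 == j :> nat)%:R
     - beta sigma DT tau * (y j * (i == j :> nat)%:R))); last first.
    by move=> j _; rewrite eqSS -val_eqE /=; ring.
  rewrite sumrB -mulr_sumr !sumE iL ltnW //.
  rewrite (eq_bigr (fun j : 'I__ => gamma sigma DT tau / alpha *
     (lam j.+1 * (i == j :> nat)%:R))); last first.
    by move=> j _; rewrite eqSS; ring.
  rewrite -mulr_sumr (sumE L (fun j => lam j.+1)) -ltnS iL; ring.
rewrite (eq_bigr (fun j : 'I__ => - (i.+1 == L)%:R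
    * (y j * (L == j :> nat)%:R))); last first.
  by move=> j _; rewrite -mulnb natrM (eq_sym L); ring.
rewrite -mulr_sumr sumE ltnSn.
rewrite (eq_bigr (fun j : 'I__ => lam j.+1 * (i == j :> nat)%:R
     - beta sigma DT tau * (lam j.+1 * (i.+1 == j :> nat)%:R))); last first.
  by move=> j _; rewrite -val_eqE (eq_sym (nat_of_ord j)) /=; ring.
rewrite sumrB -mulr_sumr (sumE L (fun j => lam j.+1) i).
rewrite (sumE L (fun j => lam j.+1) i.+1) ltn_ord.
case: eqVneq => [->|iL]; first by rewrite ltnn /=; ring.
by rewrite ltn_neqAle iL ltn_ord /=; ring.
Qed.

Lemma beta_ge0 (R : realType) (sigma DT tau : R) : 0 <= beta sigma DT tau.
Proof. exact: powR_ge0. Qed.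

Lemma gamma_ge0 (R : realType) (sigma DT tau : R) :
  sigma < 0 -> 0 < tau -> 0 <= DT -> 0 <= gamma sigma DT tau.
Proof.
move=> s0 t0 D0.
have st : sigma * tau < 0 by rewrite nmulr_rlt0.
have b1 : beta sigma DT tau <= 1.
  rewrite -(powRr0 (1 - sigma * tau)) ler_powR //; first by lra.
  by rewrite oppr_le0 divr_ge0 // ltW.
have b0 := beta_ge0 sigma DT tau.
rewrite /gamma mulr_le0 ?invr_le0 //.
  by rewrite subr_le0 expr_le1.
by rewrite ltW // nmulr_rlt0 //; lra.
Qed.

(* The inverses written [invmx] above are genuine inverses. *)
Lemma paraopt_mx_unit (R : realType) (L : nat) (alpha sigma DT tau : R) :
  0 < alpha -> sigma < 0 -> 0 < tau -> 0 <= DT ->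
  paraopt_mx L alpha sigma DT tau \in unitmx.
Proof.
move=> a0 s0 t0 D0; rewrite -unitmx_tr -row_free_unit -kermx_eq0.
apply/rowV0P => v /sub_kermxP /(congr1 trmx).
rewrite trmx_mul trmxK trmx0 => Av; apply: trmx_inj; rewrite trmx0.
move: (v^T) Av => {v} X.
pose y l := usubmx X (inord l) 0.
pose lam l := if insub l.-1 is Some i then dsubmx X (i : 'I_L) 0 else 0.
have -> : X = col_mx (\col_(i < L.+1) y i) (\col_(i < L) lam i.+1).
  rewrite -[LHS]vsubmxK; congr col_mx; apply/colP => i; rewrite [RHS]mxE.
    by rewrite /y inord_val.
  by rewrite /lam /= valK.
move: y lam => y lam; rewrite paraopt_mx_mulE -[0]col_mx0.
move=> /eq_col_mx [/colP yE /colP lE].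
have b0 := beta_ge0 sigma DT tau; have g0 := gamma_ge0 s0 t0 D0.
have {}g0 : 0 <= gamma sigma DT tau / alpha by rewrite divr_ge0 // ltW.
move: (beta _ _ _) (gamma _ _ _ / alpha) b0 g0 yE lE => b g b0 g0 yE lE.
have y0 : y 0%N = 0 by have := yE ord0; rewrite !mxE.
have yS l : (l < L)%N -> y l.+1 = b * y l - g * lam l.+1.
  by move=> lL; have := yE (inord l.+1); rewrite !mxE inordK //=; lra.
have lamL : (0 < L)%N -> lam L = y L.
  move=> L0; have iL : (L.-1 < L)%N by rewrite prednK.
  by have := lE (Ordinal iL); rewrite !mxE /= prednK // eqxx; lra.
have lamE l : (l < L)%N -> lam (L - l)%N = b ^+ l * y L.
  elim: l => [|l IH] lL; first by rewrite subn0 lamL // mul1r.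
  have iL : ((L - l.+1).-1 < L)%N by lia.
  have := lE (Ordinal iL); rewrite !mxE /= ifN; last by lia.
  rewrite (_ : (L - l.+1).-1.+2 = (L - l)%N); last by lia.
  rewrite (_ : (L - l.+1).-1.+1 = (L - l.+1)%N); last by lia.
  rewrite IH 1?ltnW // exprS; lra.
have yy l : (l <= L)%N -> y l * y L <= 0.
  elim: l => [|l IH] lL; first by rewrite y0 mul0r.
  rewrite yS // -(subKn lL) lamE; last by lia.
  rewrite mulrBl subr_le0 -mulrA.
  apply: (@le_trans _ _ 0); first by rewrite mulr_ge0_le0 // IH // ltnW.
  by rewrite -!mulrA mulr_ge0 // mulr_ge0 ?exprn_ge0 // -expr2 sqr_ge0.
have yL : y L = 0.
  apply/eqP; rewrite -sqrf_eq0; apply/eqP/le_anti.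
  by rewrite sqr_ge0 andbT expr2 yy.
have lam0 l : (l < L)%N -> lam l.+1 = 0.
  by move=> lL; rewrite -(subKn lL) lamE ?yL ?mulr0 //; lia.
have yz l : (l <= L)%N -> y l = 0.
  elim: l => [|l IH] lL //; rewrite yS // IH 1?ltnW // lam0 //; lra.
congr col_mx; apply/colP => i; rewrite !mxE.
  by rewrite yz // -ltnS.
by rewrite lam0.
Qed.

(* Main.v *)
Require Import Defs.
From mathcomp Require Import all_boot all_order all_algebra.
From mathcomp Require Import all_classical all_reals all_analysis.
From mathcomp Require Import complex.
From mathcomp Require Import ring lra zify.
Set Implicit Arguments.
Unset Strict Implicit.
Unset Printing Implicit Defensive.
Import Order.TTheory GRing.Theory Num.Theory.
Import numFieldNormedType.Exports.
Import Normc.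
Local Open Scope ring_scope.

(** Write [z = - sigma * Dt], [b1], [b0] for the coarse and fine [beta],
[G = gamma_Dt / alpha] and [D = (gamma_dt - gamma_Dt) / alpha].

If [mu != 0] is an eigenvalue of the iteration matrix, the pencil
[(1 - mu) A_Dt - A_dt] is singular, and it equals [- mu] times a matrix of the
same shape as [A_Dt] with [b1], [G] replaced by [b = b1 - (b1 - b0) / mu] and
[g = G + D / mu].  Eliminating the unknowns of such a matrix leads to the
scalar equation [1 + g * (1 + b^2 + ... + b^(2(L-1))) = 0]
([coupled_mx_unit], [iteration_eigenvalue_coupled]).

Two comparisons of the coarse and fine propagators control the coefficients.
First, [b1 - b0 <= c (1 - b1)] for every [c] with
[1 - c z <= (1 + z) exp (- z)], by Bernoulli's inequality for the real exponent
[DT / Dt >= 1] ([beta_gap]); [c = 3/10] and [c = z] qualify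
([euler_gap_lin], [euler_gap_quad]).  Then [D <= (z / 2 + c) G]
([gamma_gap]).

Suppose [|mu| > 3/10].  By the first comparison [b] is a convex combination of
[1] and a point of modulus at most [e = 3 / (10 |mu|) < 1], so
[1 - |b|^2 >= (1 - b1) (1 - e^2)].  Put [w = b^2], [u = w^L], so that the
equation becomes [(1 - w) + g (1 - u) = 0], and take real parts.  Since
[|u| <= 1], [Re (1 - u) >= |1 - u|^2 / 2]: the result is a quadratic inequality
in [|1 - u|] which has a solution only if
[D^2 >= 2 G (1 - b1) (|mu|^2 - (3/10)^2)], whatever [L] is
([coupled_root_modulus]).  Comparing with [D <= (z / 2 + c) G] gives
[|mu| <= 3/10 + (3/4) Dt / (alpha + sqrt (alpha Dt))]
([paraopt_eigenvalue_le]).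

The constant [3/4] instead of [79/100] matters for convergence: at
[alpha = 0.4544 Dt] the bound with [79/100] slightly exceeds [1].  With [3/4]
every eigenvalue has modulus less than [1], hence the powers of the iteration
matrix tend to [0] ([powers_cvg0]). *)

(** * Exponential inequalities *)

(** The remainder of order two has the sign of [x]; stating it through a
nonnegative quotient [q] lets the sign survive a product with [x]. *)
Lemma expR_quad_sign (R : realType) (x : R) :
  exists2 q : R, 0 <= q & expR x - 1 - x - x ^+ 2 / 2 = q * x.
Proof.
pose f (t : R) := expR t - 1 - t - t ^+ 2 / 2.
have df (t : R) : is_derive t 1 f (expR t - 1 - t).
  apply: is_derive_eq; rewrite /GRing.scale /=; by field.
have cf (a b : R) : {within `[a, b], continuous f}%classic.
  by apply: derivable_within_continuous => t _;
    exact: (@ex_derive _ _ _ _ _ _ _ (df t)).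
have f0 : f 0 = 0 by rewrite /f expR0; field.
rewrite -/(f x).
case: (ltgtP x 0) => [x0|x0|->]; last by exists 0 => //; rewrite f0 mulr0.
- have [c _] := MVT x0 (fun t _ => df t) (cf x 0).
  rewrite f0 sub0r sub0r => /eqP; rewrite mulrN eqr_opp => /eqP ->.
  exists (expR c - 1 - c) => //; have := expR_ge1Dx c; lra.
- have [c _] := MVT x0 (fun t _ => df t) (cf 0 x).
  rewrite f0 !subr0 => ->.
  exists (expR c - 1 - c) => //; have := expR_ge1Dx c; lra.
Qed.

Lemma expR_ge_cubic (R : realType) (x : R) :
  1 + x + x ^+ 2 / 2 + x ^+ 3 / 6 <= expR x.
Proof.
pose f (t : R) := expR t - 1 - t - t ^+ 2 / 2 - t ^+ 3 / 6.
have df (t : R) : is_derive t 1 f (expR t - 1 - t - t ^+ 2 / 2).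
  apply: is_derive_eq; rewrite /GRing.scale /=; by field.
have cf (a b : R) : {within `[a, b], continuous f}%classic.
  by apply: derivable_within_continuous => t _;
    exact: (@ex_derive _ _ _ _ _ _ _ (df t)).
have f0 : f 0 = 0 by rewrite /f expR0; field.
suff: 0 <= f x by rewrite /f; lra.
case: (ltgtP x 0) => [x0|x0|->]; last by rewrite f0.
- have [c /[!in_itv]/andP[_ c0]] := MVT x0 (fun t _ => df t) (cf x 0).
  have [q q0 ->] := expR_quad_sign c; rewrite f0.
  have : 0 <= q * (c * x) by rewrite mulr_ge0 // mulr_le0 // ltW.
  lra.
- have [c /[!in_itv]/andP[c0 _]] := MVT x0 (fun t _ => df t) (cf 0 x).
  have [q q0 ->] := expR_quad_sign c; rewrite f0.
  have : 0 <= q * (c * x) by rewrite mulr_ge0 // mulr_ge0 // ltW.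
  lra.
Qed.

(** [(1 + z) exp (- z)] is the damping of the exact flow over one step divided
by that of implicit Euler.  For small [z] this bound is better than the linear
one below. *)
Lemma euler_gap_quad (R : realType) (z : R) : 0 < z ->
  1 - z * z <= (1 + z) * expR (- z).
Proof. move=> z0; have := expR_ge1Dx (- z); nra. Qed.

(** This is nearly sharp: the maximum of [(1 - (1 + z) exp (- z)) / z] is about
[0.2984], near [z = 1.79].  Hence the cubic minorant of [exp] is expanded at
[9/5], close to the maximizer, except for small [z], where the expansion at
[0] suffices, and for large [z], where the left-hand side is not positive. *)
Lemma euler_gap_lin (R : realType) (z : R) : 0 < z ->
  1 - 3 / 10 * z <= (1 + z) * expR (- z).
Proof.
move=> z0; have [zs|zs] := leP z (1 / 2).
  have := expR_ge_cubic (- z).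
  rewrite -(ler_pM2l (_ : 0 < 1 + z)); last by lra.
  apply: le_trans; nra.
have [zl|zl] := leP (1 - 3 / 10 * z) 0.
  by apply: le_trans zl _; rewrite mulr_ge0 ?expR_ge0 //; lra.
pose t : R := z - 9 / 5.
have -> : - z = 6%:R * (- (3 / 10)) - t by rewrite /t; field.
rewrite expRD expRM_natl.
have e6 : 329 / 2000 <= expR (- (3 / 10)) ^+ 6 :> R.
  apply: (@le_trans _ _ ((77 / 104) ^+ 6)); first by lra.
  rewrite lerXn2r ?nnegrE ?expR_ge0 //.
  by apply: (le_trans _ (expR_ge_cubic _)); lra.
have et := expR_ge_cubic (- t).
apply: (@le_trans _ _ ((1 + z) * (329 / 2000 *
    (1 - t + t ^+ 2 / 2 - t ^+ 3 / 6)))); last first.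
  rewrite ler_pM2l; last by lra.
  apply: (@le_trans _ _ (329 / 2000 * expR (- t))).
    by rewrite ler_pM2l; lra.
  by rewrite ler_wpM2r ?expR_ge0.
have -> : z = t + 9 / 5 by rewrite /t; ring.
(* The endpoints of the remaining interval: z = 1/2 and z = 10/3. *)
have t1 : - (13 / 10) <= t by rewrite /t; lra.
have t2 : t <= 23 / 15 by rewrite /t; lra.
have t3 : 0 <= t ^+ 2 * ((t + 13 / 10) * (23 / 15 - t)).
  by apply: mulr_ge0; [exact: sqr_ge0 | apply: mulr_ge0; lra].
have t4 : 0 <= t ^+ 2 * (23 / 15 - t).
  by apply: mulr_ge0; [exact: sqr_ge0 | lra].
have t5 : 0 <= (t + 1 / 4) ^+ 2 by exact: sqr_ge0.
have t6 : 0 <= t ^+ 2 by exact: sqr_ge0.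
lra.
Qed.

(** With [x = exp s], two tangent-line bounds suffice:
[exp ((k - 1) s) >= 1 + (k - 1) s] and [x s >= x - 1]. *)
Lemma powR_bernoulli (R : realType) (x k : R) : 0 < x -> 1 <= k ->
  1 + k * (x - 1) <= x `^ k.
Proof.
move=> x0 k1; rewrite /powR gt_eqF //.
set s := ln x; have xs : expR s = x by rewrite /s lnK // posrE.
have -> : k * s = s + (k - 1) * s by ring.
rewrite expRD xs.
have e1 := expR_ge1Dx ((k - 1) * s).
have xs1 : x - 1 <= x * s.
  have := expR_ge1Dx (- s); rewrite expRN xs => h.
  have : x * (1 - s) <= x * x^-1 by rewrite ler_pM2l.
  rewrite divff ?gt_eqF //; lra.
have k0 : 0 <= k - 1 by lra.
have := ler_wpM2l (ltW x0) e1; have := ler_wpM2l k0 xs1; nra.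
Qed.

(** * Comparison of the coarse and fine propagators *)

Lemma beta_powR (R : realType) (sigma DT tau : R) :
  beta sigma DT tau = ((1 + - sigma * tau) `^ (DT / tau))^-1.
Proof. by rewrite /beta -powRN mulNr. Qed.

Lemma beta_gt0 (R : realType) (sigma DT tau : R) :
  sigma < 0 -> 0 < tau -> 0 < beta sigma DT tau.
Proof.
move=> s0 t0; rewrite beta_powR invr_gt0 powR_gt0 // addr_gt0 //.
by rewrite mulr_gt0 // oppr_gt0.
Qed.

Lemma beta_le_euler (R : realType) (sigma DT tau : R) :
  sigma < 0 -> 0 < tau -> tau <= DT ->
  (1 + - sigma * tau) * beta sigma DT tau <= 1.
Proof.
move=> s0 t0 tD; have z0 : 0 < - sigma * tau by rewrite mulr_gt0 // oppr_gt0.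
rewrite beta_powR ler_pdivrMr ?mul1r; last by rewrite powR_gt0 // addr_gt0.
apply: le1r_powR; first by rewrite lerDl ltW.
by rewrite ler_pdivlMr // mul1r.
Qed.

Section PropagationFactors.
Variables (R : realType) (sigma DT Dt dt : R).
Hypotheses (sigma_lt0 : sigma < 0) (dt_gt0 : 0 < dt) (dt_le : dt <= Dt)
  (Dt_le : Dt <= DT).

Let b1 := beta sigma DT Dt.
Let b0 := beta sigma DT dt.
Let z := - sigma * Dt.

Let Dt_gt0 : 0 < Dt. Proof. exact: lt_le_trans dt_gt0 dt_le. Qed.
Let z_gt0 : 0 < z. Proof. by rewrite mulr_gt0 // oppr_gt0. Qed.
Let y_gt0 : 0 < - sigma * dt. Proof. by rewrite mulr_gt0 // oppr_gt0. Qed.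
Let ratio_ge1 : 1 <= DT / Dt. Proof. by rewrite ler_pdivlMr // mul1r. Qed.
Let betaE : b1 = ((1 + z) `^ (DT / Dt))^-1. Proof. exact: beta_powR. Qed.

(** [(1 + y) ^ (1 / y)] decreases in [y > 0], which is Bernoulli's inequality
with exponent [Dt / dt]. *)
Lemma beta_fine_le : b0 <= b1.
Proof.
have z0 := z_gt0.
have s0 : 0 < 1 + - sigma * dt.
  by rewrite addr_gt0.
rewrite betaE /b0 beta_powR lef_pV2 ?posrE ?powR_gt0 ?addr_gt0 //.
have -> : DT / dt = Dt / dt * (DT / Dt) by field; rewrite !gt_eqF.
rewrite (powRrM _ (Dt / dt)) ge0_ler_powR ?nnegrE ?powR_ge0 //.
- exact: le_trans ratio_ge1.
- lra.
apply: (le_trans _ (powR_bernoulli s0 _)); last by rewrite ler_pdivlMr ?mul1r.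
by rewrite /z (_ : 1 + - sigma * dt - 1 = - sigma * dt); [|ring];
  rewrite mulrCA divfK ?gt_eqF.
Qed.

(** Let [k = DT / Dt].  As [b0 >= exp (- k z)], the ratio [b0 / b1] is at least
[((1 + z) exp (- z)) ^ k], and the hypothesis is the case [k = 1].  Bernoulli's
inequality bounds both sides by terms linear in [k], so the case [k = 1] is the
worst one. *)
Lemma beta_gap (c : R) : 0 <= c -> 1 - c * z <= (1 + z) * expR (- z) ->
  b1 - b0 <= c * (1 - b1).
Proof.
move=> c0 vc; have z0 := z_gt0.
set k := DT / Dt; have k1 : 1 <= k by exact: ratio_ge1.
have B0 : 0 < 1 + z by lra.
have Bp : 0 < (1 + z) `^ k by rewrite powR_gt0.
have b1E : (1 + z) `^ k * b1 = 1 by rewrite betaE divff // gt_eqF.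
have b1p : 0 < b1 by exact: beta_gt0.
have b0E : expR (- z) `^ k <= b0.
  rewrite -expRM /b0 /beta /powR gt_eqF; last first.
    by rewrite -mulNr addr_gt0.
  rewrite ler_expR (_ : - z * k = - (DT / dt) * (- sigma * dt)).
    rewrite !mulNr lerN2 ler_wpM2l //.
      by rewrite divr_ge0 ?(ltW dt_gt0) // ltW // (lt_le_trans Dt_gt0).
    apply: le_ln1Dx; rewrite -mulNr.
    by apply: (lt_trans _ y_gt0); rewrite ltrN10.
  by rewrite /z /k; field; rewrite !gt_eqF.
have vk : 1 - k * (c * z) <= (1 + z) `^ k * b0.
  apply: (@le_trans _ _ (((1 + z) * expR (- z)) `^ k)).
    apply: (le_trans _ (powR_bernoulli _ k1)); last first.
      by rewrite mulr_gt0 ?expR_gt0.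
    have k0 : 0 <= k by lra.
    by have := ler_wpM2l k0 vc; lra.
  rewrite powRM ?expR_ge0 //; last exact: ltW.
  by rewrite ler_pM2l.
have Bk := powR_bernoulli B0 k1.
rewrite -(ler_pM2l Bp) mulrBr b1E mulrCA mulrBr mulr1 b1E.
by have := ler_wpM2l c0 Bk; lra.
Qed.

(** The part [z / 2] comes from the denominators [2 + z] and [2 - sigma * dt],
the latter being replaced by [2]; the part [c] comes from the numerators, where
[(b1 + b0) (2 + z) <= 2 (1 + b1)] because [(1 + z) b1 <= 1]. *)
Lemma gamma_gap (c : R) : b1 - b0 <= c * (1 - b1) ->
  0 <= gamma sigma DT dt - gamma sigma DT Dt
    <= (z / 2 + c) * gamma sigma DT Dt.
Proof.
move=> gap; have z0 := z_gt0; have b1p : 0 < b1 by exact: beta_gt0.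
have b1z : (1 + z) * b1 <= 1 by exact: beta_le_euler.
have b01 := beta_fine_le; have b00 : 0 <= b0 by exact: beta_ge0.
have b1_lt1 : b1 < 1 by nra.
pose y := - sigma * dt.
have y0 : 0 < y by exact: y_gt0.
have yz : y <= z by rewrite /y /z ler_wpM2l // oppr_ge0 ltW.
have s0 : 0 < - sigma by rewrite oppr_gt0.
have gE (t b : R) : 0 < - sigma * t ->
    (b ^+ 2 - 1) / (sigma * (2 - sigma * t)) =
    (1 - b ^+ 2) / (- sigma * (2 + - sigma * t)).
  move=> t0; rewrite -[LHS]mulrNN -invrN; congr (_ * _^-1); ring.
rewrite /gamma -/b1 -/b0 !gE // -/y -/z.
rewrite subr_ge0 lerBlDr; apply/andP; split.
  apply: ler_pM.
  - by rewrite subr_ge0 expr_le1 // ltW.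
  - by rewrite invr_ge0 mulr_ge0 //; lra.
  - by rewrite lerB // lerXn2r ?nnegrE // ltW.
  by rewrite lef_pV2 ?posrE ?mulr_gt0 // ?ler_pM2l //; lra.
apply: (@le_trans _ _ ((1 - b0 ^+ 2) / (- sigma * 2))).
  apply: ler_wpM2l; first by rewrite subr_ge0 expr_le1 //; lra.
  by rewrite lef_pV2 ?posrE ?mulr_gt0 // ?ler_pM2l //; lra.
rewrite ler_pdivrMr ?mulr_gt0 //.
have -> : ((z / 2 + c) * ((1 - b1 ^+ 2) / (- sigma * (2 + z))) +
    (1 - b1 ^+ 2) / (- sigma * (2 + z))) * (- sigma * 2) =
    (z + 2 + 2 * c) * (1 - b1 ^+ 2) / (2 + z).
  field; rewrite (lt_eqF sigma_lt0) gt_eqF //; lra.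
rewrite ler_pdivlMr; last by lra.
have h1 : (b1 - b0) * ((b1 + b0) * (2 + z)) <=
    c * (1 - b1) * (2 * (1 + b1)).
  apply: ler_pM => //; first by rewrite subr_ge0.
    by rewrite mulr_ge0 //; lra.
  apply: (@le_trans _ _ (2 * b1 * (2 + z))); last by lra.
  by rewrite ler_wpM2r //; lra.
lra.
Qed.

End PropagationFactors.

(** * Modulus of complex numbers *)

Section Modulus.
Variable R : rcfType.
Implicit Types x : R[i].

Lemma normc_ge0 x : 0 <= normc x.
Proof. by case: x => a b; apply: sqrtr_ge0. Qed.

Lemma normc_sqrE x : normc x ^+ 2 = complex.Re x ^+ 2 + complex.Im x ^+ 2.
Proof. by case: x => a b /=; rewrite sqr_sqrtr // addr_ge0 ?sqr_ge0. Qed.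

Lemma norm_Re_le x : `|complex.Re x| <= normc x.
Proof.
rewrite -(ler_sqr (normr_ge0 _) (normc_ge0 _)) real_normK ?num_real //.
by rewrite normc_sqrE lerDl sqr_ge0.
Qed.

Lemma normc_real (a : R) : normc a%:C%C = `|a|.
Proof. by rewrite /= expr0n /= addr0 sqrtr_sqr. Qed.

Lemma normcX x n : normc (x ^+ n) = normc x ^+ n.
Proof.
by elim: n => [|n IH]; rewrite ?normc1 // !exprS normcM IH.
Qed.

Lemma normcB_le x y : normc (x - y) <= normc x + normc y.
Proof. by rewrite -(normcN y); apply: le_normcD. Qed.

End Modulus.

(** * The scalar equation for the eigenvalues *)

Section CoupledSystem.
Variable F : fieldType.

(** Making the two entries free parameters over any field gives a family that
contains, up to scalars, the pencil [(1 - mu) A_Dt - A_dt] over the complex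
numbers. *)
Definition coupled_mx (L : nat) (b g : F) : 'M[F]_(L.+1 + L) :=
  block_mx
    (\matrix_(i < L.+1, j < L.+1) ((i == j)%:R - b * (i == j.+1 :> nat)%:R))
    (\matrix_(i < L.+1, j < L) (g * (i == j.+1 :> nat)%:R))
    (\matrix_(i < L, j < L.+1) (- ((i.+1 == L) && (j == L :> nat))%:R))
    (\matrix_(i < L, j < L) ((i == j)%:R - b * (j == i.+1 :> nat)%:R)).

Let sum_pick (n m : nat) (f : nat -> F) :
  \sum_(j < n) (m == j :> nat)%:R * f j = if (m < n)%N then f m else 0.
Proof.
case: ltnP => mn.
  rewrite (bigD1 (Ordinal mn)) //= eqxx mul1r big1 ?addr0 // => j jm.
  by rewrite (_ : (m == j) = false) ?mul0r // eq_sym; apply/negbTE.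
rewrite big1 // => j _; rewrite (_ : (m == j) = false) ?mul0r //.
by apply/negbTE; rewrite neq_ltn (leq_trans (ltn_ord j) mn) orbT.
Qed.

(** On a kernel vector the adjoint equations give [Lambda_l = b ^ (L - l) Y_L];
inserting this in the forward recursion, started from [Y_0 = 0], yields
[Y_L = - g Y_L (1 + b^2 + ... + b^(2(L-1)))], so the whole vector vanishes
with [Y_L]. *)
Lemma coupled_mx_unit (L : nat) (b g : F) :
  1 + g * \sum_(j < L) (b ^+ 2) ^+ j != 0 -> coupled_mx L b g \in unitmx.
Proof.
move=> S0; rewrite -unitmx_tr -row_free_unit -kermx_eq0.
apply/rowV0P => v /sub_kermxP /(congr1 trmx).
rewrite trmx_mul trmxK trmx0 => Av; apply: trmx_inj; rewrite trmx0.
move: (v^T) Av => {v} X; rewrite -[X]vsubmxK.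
move: (usubmx X) (dsubmx X) => Y Lam {X}.
pose y l := Y (inord l) 0.
(* lam l stands for Lambda_(l+1), and is 0 for l >= L. *)
pose lam l := if insub l is Some i then Lam (i : 'I_L) 0 else 0.
have yX (i : 'I_L.+1) : Y i 0 = y i by rewrite /y inord_val.
have lamX (i : 'I_L) : Lam i 0 = lam i by rewrite /lam valK.
rewrite /coupled_mx mul_block_col -[0]col_mx0.
move=> /eq_col_mx [/colP yE /colP lE].
have y0 : y 0%N = 0.
  have := yE ord0; rewrite !mxE; under eq_bigr do rewrite !mxE yX.
  under [X in _ + X]eq_bigr do rewrite !mxE.
  rewrite [X in _ + X]big1 ?addr0 => [|j _]; last by rewrite mulr0 mul0r.
  rewrite (eq_bigr (fun j : 'I__ => (0%N == j :> nat)%:R * y j)).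
    by rewrite sum_pick.
  by move=> j _; rewrite mulr0 subr0.
have yS l : (l < L)%N -> y l.+1 = b * y l - g * lam l.
  move=> lL; have := yE (inord l.+1).
  rewrite !mxE; under eq_bigr do rewrite !mxE yX.
  under [X in _ + X]eq_bigr do rewrite !mxE lamX.
  rewrite inordK // (eq_bigr (fun j : 'I__ => (l.+1 == j :> nat)%:R * y j -
      b * ((l == j :> nat)%:R * y j))); last first.
    by move=> j _; rewrite -val_eqE /= inordK // eqSS; ring.
  rewrite sumrB -mulr_sumr !sum_pick ltnS lL ltnW //.
  rewrite (eq_bigr (fun j : 'I__ => g * ((l == j :> nat)%:R * lam j)));
    last by move=> j _; rewrite eqSS mulrA.
  rewrite -mulr_sumr sum_pick lL => row.
  by apply/eqP; rewrite -subr_eq0 -[X in _ == X]row; apply/eqP; ring.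
have lamS i : (i < L)%N -> lam i = (i.+1 == L)%:R * y L + b * lam i.+1.
  move=> iL; have := lE (Ordinal iL).
  rewrite !mxE; under eq_bigr do rewrite !mxE yX.
  under [X in _ + X]eq_bigr do rewrite !mxE lamX.
  rewrite (eq_bigr (fun j : 'I__ => - (i.+1 == L)%:R *
      ((L == j :> nat)%:R * y j))); last first.
    by move=> j _; rewrite -mulnb natrM (eq_sym L) /=; ring.
  rewrite -mulr_sumr sum_pick ltnSn.
  rewrite (eq_bigr (fun j : 'I__ => (i == j :> nat)%:R * lam j -
      b * ((i.+1 == j :> nat)%:R * lam j))); last first.
    by move=> j _; rewrite -val_eqE (eq_sym (nat_of_ord j)) /=; ring.
  rewrite sumrB -mulr_sumr !sum_pick iL.
  have -> : (if (i.+1 < L)%N then lam i.+1 else 0) = lam i.+1.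
    by case: ifP => // iL'; rewrite /lam insubF.
  move=> row.
  by apply/eqP; rewrite -subr_eq0 -[X in _ == X]row; apply/eqP; ring.
have lamE l : (l < L)%N -> lam (L - l.+1)%N = b ^+ l * y L.
  elim: l => [|l IH] lL; rewrite lamS; try lia.
    rewrite (_ : (L - 1).+1 = L); last by lia.
    by rewrite /lam insubF ?ltnn // eqxx mulr0 addr0.
  rewrite (_ : (L - l.+2).+1 = L - l.+1)%N; last by lia.
  rewrite IH 1?ltnW // (_ : (L - l.+1 == L)%N = false); last by lia.
  by rewrite mul0r add0r exprS mulrA.
have y_closed l : (l <= L)%N ->
    y l = - (g * y L * b ^+ (L - l) * \sum_(j < l) (b ^+ 2) ^+ j).
  elim: l => [|l IH] lL; first by rewrite y0 big_ord0 mulr0 oppr0.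
  rewrite yS // IH 1?ltnW // big_ord_recl.
  under [in RHS]eq_bigr => j _ do rewrite lift0 exprS.
  rewrite -mulr_sumr (_ : (L - l = (L - l.+1).+1)%N); last by lia.
  rewrite (_ : lam l = b ^+ (L - l.+1) * y L); last first.
    by rewrite -lamE; [congr lam|]; lia.
  by rewrite /= expr0; move: (L - l.+1)%N => k; rewrite [b ^+ k.+1]exprS; ring.
have yL : y L = 0.
  have := y_closed L (leqnn L); rewrite subnn expr0 mulr1 => /eqP.
  rewrite -addr_eq0 -mulrA mulrCA -{1}[y L]mulr1 -mulrDr mulf_eq0.
  by rewrite (negbTE S0) orbF => /eqP.
have lam0 l : (l < L)%N -> lam l = 0.
  move=> lL; rewrite (_ : l = L - (L - l.+1).+1)%N; last by lia.
  by rewrite lamE ?yL ?mulr0 //; lia.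
congr col_mx; apply/colP => i.
  rewrite yX mxE y_closed ?yL ?mulr0 ?mul0r ?oppr0 //.
  by rewrite -ltnS.
by rewrite lamX mxE lam0.
Qed.

End CoupledSystem.

Lemma map_coupled_mx (F K : fieldType) (f : {rmorphism F -> K}) (L : nat)
    (b g : F) :
  map_mx f (coupled_mx L b g) = coupled_mx L (f b) (f g).
Proof.
rewrite /coupled_mx map_block_mx; congr block_mx; apply/matrixP => i j;
  by rewrite !mxE ?rmorphB ?rmorphN ?rmorphM /= ?rmorph_nat.
Qed.

Lemma paraopt_mxE (R : realType) (L : nat) (alpha sigma DT tau : R) :
  paraopt_mx L alpha sigma DT tau =
  coupled_mx L (beta sigma DT tau) (gamma sigma DT tau / alpha).
Proof. by []. Qed.

Lemma iteration_eigenvalue_coupled (F : fieldType) (L : nat)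
    (b1 g1 b0 g0 mu : F) :
  coupled_mx L b1 g1 \in unitmx -> mu != 0 ->
  eigenvalue (1%:M - invmx (coupled_mx L b1 g1) *m coupled_mx L b0 g0) mu ->
  1 + (g1 + (g0 - g1) / mu) *
    \sum_(j < L) ((b1 - (b1 - b0) / mu) ^+ 2) ^+ j = 0.
Proof.
move=> uA mu0 /eigenvalueP[v vM v0]; apply/eqP; apply/negPn/negP => S0.
have := coupled_mx_unit S0; set b := b1 - _; set g := g1 + _ => uC.
pose u := v *m invmx (coupled_mx L b1 g1).
have uAv : u *m coupled_mx L b1 g1 = v by rewrite mulmxKV.
have pencil : (1 - mu) *: coupled_mx L b1 g1 - coupled_mx L b0 g0 =
    - mu *: coupled_mx L b g.
  rewrite /coupled_mx !scale_block_mx opp_block_mx add_block_mx.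
  by congr block_mx; apply/matrixP => i j; rewrite !mxE /b /g; field.
have uC0 : u *m coupled_mx L b g = 0.
  apply: (scalerI (_ : - mu != 0)); first by rewrite oppr_eq0.
  rewrite scaler0 scalemxAr -pencil mulmxBr -scalemxAr uAv.
  by move: vM; rewrite mulmxBr mulmx1 mulmxA -/u scalerBl scale1r => <-;
    rewrite subKr subrr.
have u0 : u = 0 by rewrite -[u](mulmxK uC) uC0 mul0mx.
by move: v0; rewrite -uAv u0 mul0mx eqxx.
Qed.

(** * The eigenvalue bound *)

(** With [m = |mu|] and [rho = |1 - u|], the real part of
[(1 - w) + g (1 - u) = 0] reads at best
[P + G rho^2 / 2 <= (D / m) rho] with [P = (1 - b1) (1 - (3 / (10 m))^2)], and
the discriminant of this quadratic in [rho] gives the conclusion. *)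
Lemma coupled_root_modulus (R : realType) (L : nat)
    (b1 b0 G D : R) (mu : R[i]) :
  0 <= b1 -> b1 < 1 -> 0 <= b1 - b0 -> b1 - b0 <= 3 / 10 * (1 - b1) ->
  0 <= G -> 0 <= D -> 3 / 10 < normc mu ->
  1 + (G%:C%C + D%:C%C / mu) *
    \sum_(j < L) ((b1%:C%C - (b1 - b0)%:C%C / mu) ^+ 2) ^+ j = 0 ->
  2 * G * ((1 - b1) * (normc mu ^+ 2 - (3 / 10) ^+ 2)) <= D ^+ 2.
Proof.
move=> b1_ge0 b1_lt1 gap0 gap G0 D0; set m := normc mu => m_gt.
set b := _ - _; set w := b ^+ 2 => root.
have m0 : 0 < m by lra.
set u := w ^+ L.
have rootw : 1 - w + (G%:C%C + D%:C%C / mu) * (1 - u) = 0.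
  have -> : 1 - u = (1 - w) * \sum_(j < L) w ^+ j.
    by rewrite -[LHS]opprB subrX1 -mulNr opprB.
  by rewrite mulrCA -[X in X + _]mulr1 -mulrDr root mulr0.
(* |b| <= b1 + (1 - b1) e, and squaring is convex. *)
pose e := 3 / 10 / m.
have e0 : 0 < e by rewrite divr_gt0 //; lra.
have e1 : e < 1 by rewrite ltr_pdivrMr // mul1r.
have nb : normc b <= b1 + (1 - b1) * e.
  apply: le_trans (normcB_le _ _) _.
  rewrite normcM normcV !normc_real !ger0_norm // -/m lerD2l /e mulrA.
  by rewrite ler_pM2r ?invr_gt0 // mulrC.
have nb0 := normc_ge0 b.
have nb2 : normc b ^+ 2 <= 1 - (1 - b1) * (1 - e ^+ 2).
  apply: (@le_trans _ _ ((b1 + (1 - b1) * e) ^+ 2)).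
    by rewrite lerXn2r ?nnegrE //; nra.
  have : 0 <= b1 * (1 - b1) * (1 - e) ^+ 2.
    by rewrite mulr_ge0 ?sqr_ge0 // mulr_ge0 //; lra.
  lra.
have P0 : 0 <= (1 - b1) * (1 - e ^+ 2).
  by rewrite mulr_ge0 ?subr_ge0 ?expr_le1 // ltW.
have w_le : normc w <= 1 - (1 - b1) * (1 - e ^+ 2) by rewrite normcX.
have u_le : normc u <= 1.
  by rewrite normcX exprn_ile1 ?normc_ge0 //; lra.
have Re_w : (1 - b1) * (1 - e ^+ 2) <= complex.Re (1 - w).
  have := norm_Re_le w; rewrite raddfB /= => /(le_trans (ler_norm _)); lra.
set rho := normc (1 - u).
have rho0 : 0 <= rho by exact: normc_ge0.
have Re_u : rho ^+ 2 <= 2 * complex.Re (1 - u).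
  have u2 : normc u ^+ 2 <= 1 by rewrite expr_le1 ?normc_ge0.
  move: u2; rewrite /rho !normc_sqrE; case: (u) => x y /=; lra.
have Re_D : - (D / m * rho) <= complex.Re (D%:C%C / mu * (1 - u)).
  have := norm_Re_le (D%:C%C / mu * (1 - u)).
  rewrite !normcM normcV normc_real (ger0_norm D0) -/m -/rho ler_norml.
  by case/andP.
have Re_root : complex.Re (1 - w) + G * complex.Re (1 - u) +
    complex.Re (D%:C%C / mu * (1 - u)) = 0.
  have /(congr1 (@complex.Re R)) := rootw; rewrite mulrDl.
  move: (D%:C%C / mu * (1 - u)) => [a1 a2].
  by move: (1 - w) (1 - u) => [a3 a4] [a5 a6] /=; lra.
have em : e * m = 3 / 10 by rewrite divfK // gt_eqF.
have -> : m ^+ 2 - (3 / 10) ^+ 2 = m ^+ 2 * (1 - e ^+ 2).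
  by rewrite -em; ring.
pose P := (1 - b1) * (1 - e ^+ 2).
have main : P + G * rho ^+ 2 / 2 <= D / m * rho.
  have := ler_wpM2l G0 Re_u; rewrite /P; lra.
have -> : D = D / m * m by rewrite divfK // gt_eqF.
move: (D / m) main => d main.
have -> : 2 * G * ((1 - b1) * (m ^+ 2 * (1 - e ^+ 2))) = (2 * G * P) * m ^+ 2.
  by rewrite /P; ring.
rewrite exprMn ler_pM2r ?exprn_gt0 //.
have := ler_wpM2l G0 main; have : 0 <= (G * rho - d) ^+ 2 by exact: sqr_ge0.
lra.
Qed.

(** With [s = sqrt (Dt / alpha)], the claimed bound is [A + 3/10] where
[A = (3/4) s^2 / (1 + s)].  It is fitted so that
[(A + 3/10)^2 - (3/10)^2 - (9/25) s^2] is a square, hence nonnegative; and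
[(9/25) s^2] is what the discriminant condition requires once
[D^2 <= (18/25) z (1 + z) G^2].  The latter follows from
[D <= (z / 2 + c) G], with [c = z] for small [z] and [c = 3/10] for large
[z]. *)
Lemma paraopt_eigenvalue_le (R : realType) (L : nat)
    (alpha sigma DT Dt dt : R) (mu : R[i]) :
  0 < alpha -> sigma < 0 -> 0 < dt -> dt <= Dt -> Dt <= DT ->
  eigenvalue (map_mx (real_complex R)
    (paraopt_iter_mx L alpha sigma DT Dt dt)) mu ->
  normc mu <= 3 / 4 * Dt / (alpha + Num.sqrt (alpha * Dt)) + 3 / 10.
Proof.
move=> a0 s0 dt0 dtD DtD ev; rewrite leNgt; apply/negP => mu_gt.
have Dt0 : 0 < Dt by exact: lt_le_trans dtD.
have sq0 : 0 <= Num.sqrt (alpha * Dt) by exact: sqrtr_ge0.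
have A0 : 0 <= 3 / 4 * Dt / (alpha + Num.sqrt (alpha * Dt)).
  by rewrite divr_ge0 //; lra.
have m_gt : 3 / 10 < normc mu by lra.
have mu0 : mu != 0 by apply/eqP => mu0; move: m_gt; rewrite mu0 normc0; lra.
pose z := - sigma * Dt.
have z0 : 0 < z by rewrite mulr_gt0 // oppr_gt0.
set b1 := beta sigma DT Dt; set b0 := beta sigma DT dt.
have b1p : 0 < b1 by exact: beta_gt0.
have b1z : (1 + z) * b1 <= 1 by exact: beta_le_euler.
have b01 : b0 <= b1 by exact: beta_fine_le.
have gapl : b1 - b0 <= 3 / 10 * (1 - b1).
  by apply: beta_gap => //; exact: euler_gap_lin.
have gapq : b1 - b0 <= z * (1 - b1).
  by apply: beta_gap => //; [exact: ltW | exact: euler_gap_quad].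
have b1_lt1 : b1 < 1 by nra.
set g1 := gamma sigma DT Dt; set g0 := gamma sigma DT dt.
have /andP[g01 gl] := gamma_gap s0 dt0 dtD DtD gapl.
have /andP[_ gq] := gamma_gap s0 dt0 dtD DtD gapq.
rewrite -/g1 -/g0 -/z in g01 gl gq.
have g1E : g1 = Dt * ((1 - b1 ^+ 2) / (z * (2 + z))).
  rewrite /g1 /gamma -/b1 /z; field.
  by rewrite (lt_eqF s0) (gt_eqF Dt0) /= gt_eqF //; rewrite /z in z0; lra.
have g1_ge0 : 0 <= g1 by exact: gamma_ge0 (ltW (lt_le_trans Dt0 DtD)).
have d2 : (g0 - g1) ^+ 2 <= 18 / 25 * (z * (1 + z)) * g1 ^+ 2.
  have [zs|zl] := leP z (3 / 10).
    apply: (@le_trans _ _ (((z / 2 + z) * g1) ^+ 2)).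
      by rewrite lerXn2r ?nnegrE // mulr_ge0 //; lra.
    by rewrite exprMn ler_wpM2r ?sqr_ge0 //; nra.
  apply: (@le_trans _ _ (((z / 2 + 3 / 10) * g1) ^+ 2)).
    by rewrite lerXn2r ?nnegrE // mulr_ge0 //; lra.
  by rewrite exprMn ler_wpM2r ?sqr_ge0 //; nra.
have unitA : coupled_mx L b1 (g1 / alpha) \in unitmx.
  by rewrite -paraopt_mxE paraopt_mx_unit // (le_trans (ltW Dt0)).
have root : 1 + ((g1 / alpha)%:C%C + (g0 / alpha - g1 / alpha)%:C%C / mu) *
    \sum_(j < L) ((b1%:C%C - (b1 - b0)%:C%C / mu) ^+ 2) ^+ j = 0.
  rewrite (rmorphB (real_complex R) b1 b0).
  rewrite (rmorphB (real_complex R) (g0 / alpha) (g1 / alpha)).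
  apply: (iteration_eigenvalue_coupled _ mu0).
    by rewrite -map_coupled_mx map_unitmx.
  move: ev; rewrite /paraopt_iter_mx !paraopt_mxE map_mxB map_mx1 map_mxM.
  by rewrite map_invmx !map_coupled_mx.
have := coupled_root_modulus (ltW b1p) b1_lt1 _ gapl _ _ m_gt root.
rewrite -mulrBl subr_ge0 => /(_ b01 (divr_ge0 g1_ge0 (ltW a0)))
  /(_ (divr_ge0 g01 (ltW a0))).
apply/negP; rewrite -ltNge.
pose s := Num.sqrt (Dt / alpha).
have s_gt0 : 0 < s by rewrite sqrtr_gt0 divr_gt0.
have sE : Dt = alpha * s ^+ 2.
  by rewrite sqr_sqrtr ?divr_ge0 ?ltW // mulrC divfK // gt_eqF.
have as0 : 0 < alpha * s by rewrite mulr_gt0.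
have AE : 3 / 4 * Dt / (alpha + Num.sqrt (alpha * Dt)) =
    3 / 4 * s ^+ 2 / (1 + s).
  rewrite sE mulrA -expr2 -exprMn sqrtr_sqr (gtr0_norm as0).
  by field; rewrite !gt_eqF //; lra.
have m2 : 9 / 25 * s ^+ 2 < normc mu ^+ 2 - (3 / 10) ^+ 2.
  rewrite AE in mu_gt.
  pose A := 3 / 4 * s ^+ 2 / (1 + s).
  have AA : 9 / 25 * s ^+ 2 <= (A + 3 / 10) ^+ 2 - (3 / 10) ^+ 2.
    have -> : (A + 3 / 10) ^+ 2 - (3 / 10) ^+ 2 = 9 / 25 * s ^+ 2 +
        s ^+ 2 * ((3 / 10 - 9 / 20 * s) / (1 + s)) ^+ 2.
      by rewrite /A; field; rewrite gt_eqF //; lra.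
    by rewrite lerDl mulr_ge0 ?sqr_ge0.
  apply: (le_lt_trans AA); rewrite ltrD2r ltrXn2r ?nnegrE ?normc_ge0 //.
  by rewrite /A -AE; lra.
have g1p : 0 < g1.
  rewrite g1E mulr_gt0 // divr_gt0 //; last by rewrite mulr_gt0 //; lra.
  by rewrite subr_gt0 expr_lt1 // ltW.
rewrite expr_div_n ltr_pdivrMr ?exprn_gt0 //.
apply: (le_lt_trans d2).
have -> : 18 / 25 * (z * (1 + z)) * g1 ^+ 2 =
  2 * g1 * (1 - b1) * (alpha * (9 / 25 * s ^+ 2)) *
    ((1 + z) * (1 + b1) / (2 + z)).
  rewrite expr2 {2}g1E sE; field; rewrite !gt_eqF //; lra.
have -> : 2 * (g1 / alpha) * ((1 - b1) * (normc mu ^+ 2 - (3 / 10) ^+ 2)) *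
    alpha ^+ 2 = 2 * g1 * (1 - b1) *
      (alpha * (normc mu ^+ 2 - (3 / 10) ^+ 2)).
  by field; rewrite gt_eqF.
have K0 : 0 < 2 * g1 * (1 - b1) by apply: mulr_gt0; lra.
apply: (@le_lt_trans _ _ (2 * g1 * (1 - b1) * (alpha * (9 / 25 * s ^+ 2)))).
  rewrite ler_piMr //.
    by rewrite mulr_ge0 ?(ltW K0) // !mulr_ge0 ?sqr_ge0 ?ltW //; lra.
  by rewrite ler_pdivrMr ?mul1r; lra.
by rewrite ltr_pM2l // ltr_pM2l.
Qed.

(** * Powers of a matrix with spectral radius below one *)

Lemma contracted_seq_cvg0 (R : realType) (r : R) (x e : nat -> R) :
  0 <= r -> r < 1 -> (forall k, 0 <= x k) ->
  (forall k, x k.+1 <= r * x k + e k) ->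
  (e @ \oo --> 0 -> x @ \oo --> 0)%classic.
Proof.
move=> r0 r1 x0 xS e0; apply/cvgr0Pnorm_le => eps eps0.
pose d := eps / 2.
have d0 : 0 < d by rewrite divr_gt0.
have rd : 0 < (1 - r) * d by rewrite mulr_gt0 // subr_gt0.
move/cvgr0Pnorm_le: (e0) => /(_ _ rd)[K _ eK].
have tail j : x (K + j)%N <= r ^+ j * x K + d.
  elim: j => [|j IH]; first by rewrite addn0 mul1r lerDl ltW.
  rewrite addnS; apply: le_trans (xS _) _.
  have /(le_trans (ler_norm _)) ej := eK (K + j)%N (leq_addr j K).
  have := ler_wpM2l r0 IH; rewrite exprS; lra.
have rx : (r ^+ j * x K @[j --> \oo] --> 0)%classic.
  rewrite -[X in (_ --> X)%classic](mul0r (x K)); apply: cvgMl.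
  by apply: cvg_expr; rewrite ger0_norm.
move/cvgr0Pnorm_le: (rx) => /(_ _ d0)[J _ rJ].
exists (K + J)%N => // k /= kK; rewrite ger0_norm //.
rewrite -(subnKC (leq_trans (leq_addr J K) kK)).
apply: le_trans (tail _) _.
have rJk : `|r ^+ (k - K) * x K| <= d by apply: rJ => /=; lia.
by have := le_trans (ler_norm _) rJk; rewrite /d; lra.
Qed.

Section PowersOfContraction.
Variables (R : realType) (n : nat).

(** Peel off one factor at a time: [w = (M - z) v] is annihilated by the
remaining factors, and [x_k = M^k v] satisfies [x_(k+1) = z x_k + M^k w],
a contraction with a forcing term that tends to [0] by induction. *)
Lemma annihilated_powers_cvg0 (M : 'M[R[i]]_n.+1) (s : seq R[i])
    (v : 'cV[R[i]]_n.+1) :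
  (forall z, z \in s -> normc z < 1) ->
  \prod_(z <- s) (M - z%:M) *m v = 0 ->
  forall i, (normc ((M ^+ k *m v) i 0) @[k --> \oo] --> 0)%classic.
Proof.
elim: s v => [|z s IH] v s1.
  rewrite big_nil mul1mx => -> i.
  under eq_cvg do rewrite mulmx0 mxE normc0.
  exact: cvg_cst.
rewrite big_cons => Pv i.
have z1 : normc z < 1 by apply: s1; rewrite mem_head.
have IHs : \prod_(z <- s) (M - z%:M) *m ((M - z%:M) *m v) = 0.
  rewrite mulmxA -[RHS]Pv; congr (_ *m _).
  rewrite -[LHS]/(_ * _) -[RHS]/(_ * _); apply/esym/commr_prod => t _.
  apply: commrB; last exact: comm_mx_scalar.
  apply/commr_sym/commrB => //; exact: comm_mx_scalar.
apply: (contracted_seq_cvg0 (normc_ge0 z) z1 _ _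
    (IH _ (fun t ts => s1 t _) IHs i)) => [k|k|].
- exact: normc_ge0.
- rewrite -normcM; apply: le_trans (le_normcD _ _).
  have -> : M ^+ k.+1 *m v =
      z *: (M ^+ k *m v) + M ^+ k *m ((M - z%:M) *m v).
    rewrite mulmxBl mul_scalar_mx mulmxBr -scalemxAr addrC subrK.
    by rewrite exprSr mulmxA.
  by rewrite !mxE.
by move=> t ts; rewrite in_cons ts orbT.
Qed.

(** By Cayley-Hamilton the characteristic polynomial, split over the complex
numbers, provides an annihilating product of factors [M - z] where every [z]
is an eigenvalue. *)
Lemma powers_cvg0 (M : 'M[R]_n.+1) (v : 'cV[R]_n.+1) :
  (forall z, eigenvalue (map_mx (real_complex R) M) z -> normc z < 1) ->
  forall i, ((M ^+ k *m v) i 0 @[k --> \oo] --> 0)%classic.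
Proof.
move=> spec i; set Mc := map_mx _ M in spec.
have [s sE] := closed_field_poly_normal (char_poly Mc).
rewrite (monicP (char_poly_monic Mc)) scale1r in sE.
apply: norm_cvg0.
have normE k : normc ((Mc ^+ k *m map_mx (real_complex R) v) i 0) =
    `|(M ^+ k *m v) i 0|.
  by rewrite -rmorphXn -map_mxM mxE normc_real.
under eq_cvg do rewrite -normE.
apply: (@annihilated_powers_cvg0 _ s) => [z zs|].
  by apply: spec; rewrite eigenvalue_root_char sE root_prod_XsubC.
suff -> : \prod_(z <- s) (Mc - z%:M) = 0 by rewrite mul0mx.
rewrite -[RHS](Cayley_Hamilton Mc) sE rmorph_prod /=.
by apply: eq_bigr => z _; rewrite rmorphB /= horner_mx_X horner_mx_C.
Qed.

End PowersOfContraction.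

Lemma cvg_col (R : realType) (n : nat) (X : nat -> 'cV[R]_n) (Y : 'cV[R]_n) :
  (forall i, X k i 0 @[k --> \oo] --> Y i 0)%classic ->
  (X @ \oo --> Y)%classic.
Proof.
move=> XY; apply/cvg_ballP => eps eps0.
have : (\forall k \near \oo, forall i, ball (Y i 0) eps (X k i 0))%classic.
  by apply: filter_forall => i; move/cvg_ballP: (XY i); apply.
apply: filterS => k Xk; split => // i j.
by rewrite (ord1 j); apply: Xk.
Qed.

(** * Convergence of the algorithm *)

Lemma paraopt_seq_cvg (R : realType) (L : nat)
    (alpha sigma DT Dt dt yinit ytarget : R) :
  paraopt_mx L alpha sigma DT Dt \in unitmx ->
  paraopt_mx L alpha sigma DT dt \in unitmx ->
  (forall z, eigenvalue (map_mx (real_complex R)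
     (paraopt_iter_mx L alpha sigma DT Dt dt)) z -> normc z < 1) ->
  paraopt_converges L alpha sigma DT Dt dt yinit ytarget.
Proof.
move=> uA uB spec; pose b := paraopt_rhs L yinit ytarget.
pose X : 'cV[R]_(L.+1 + L) := invmx (paraopt_mx L alpha sigma DT dt) *m b.
exists X; split=> [|Z ZE|X0]; first by rewrite mulKVmx.
  by rewrite /X /b -ZE mulKmx.
(* The successor form of the dimension gives M its ring powers. *)
pose M : 'M[R]_((L + L).+1) := paraopt_iter_mx L alpha sigma DT Dt dt.
have fixX : X = M *m X +
    invmx (paraopt_mx L alpha sigma DT Dt) *m b.
  by rewrite mulmxBl mul1mx -mulmxA mulKVmx // subrK.
have errE k : paraopt_seq alpha sigma DT Dt dt yinit ytarget X0 k =
    X + M ^+ k *m (X0 - X).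
  elim: k => [|k IH]; first by rewrite expr0 mul1mx addrC subrK.
  rewrite /paraopt_seq iterS -/(paraopt_seq _ _ _ _ _ _ _ X0 k) IH.
  by rewrite mulmxDr addrAC -fixX exprS mulmxA.
apply: cvg_col => i; under eq_cvg do rewrite errE mxE.
have : (X i 0 + (M ^+ k *m (X0 - X)) i 0 @[k --> \oo] --> X i 0 + 0)%classic.
  by apply: cvgD; [exact: cvg_cst | exact: powers_cvg0].
by rewrite addr0.
Qed.

Theorem theorem4 (R : realType) (L N : nat) (alpha DT Dt dt : R)
    (L_ge1 : (1 <= L)%N) (N_gt0 : (0 < N)%N)
    (DT_eq : DT = N%:R * dt)
    (dt_gt0 : 0 < dt) (dt_le : dt <= Dt) (Dt_le : Dt <= DT)
    (alpha_gt0 : 0 < alpha) :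
  (forall sigma : R, sigma < 0 ->
     spectral_radius (paraopt_iter_mx L alpha sigma DT Dt dt)
       <= 79 / 100 * Dt / (alpha + Num.sqrt (alpha * Dt)) + 3 / 10)
  /\ (4544 / 10000 * Dt < alpha ->
      forall sigma yinit ytarget : R, sigma < 0 ->
        paraopt_converges L alpha sigma DT Dt dt yinit ytarget).
Proof.
have Dt_gt0 : 0 < Dt by exact: lt_le_trans dt_le.
set s := Num.sqrt (alpha * Dt).
have s_ge0 : 0 <= s by exact: sqrtr_ge0.
have den_gt0 : 0 < alpha + s by lra.
have q_ge0 : 0 <= Dt / (alpha + s) by rewrite divr_ge0 // ltW.
split=> [sigma sigma_lt0|alpha_gt sigma yinit ytarget sigma_lt0].
  rewrite /spectral_radius -mulrA; set S := image _ _.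
  have [->|S0] := eqVneq S set0; first by rewrite sup0; lra.
  apply: ge_sup; first exact/set0P.
  move=> _ [z /= ev <-].
  have := paraopt_eigenvalue_le alpha_gt0 sigma_lt0 dt_gt0 dt_le Dt_le ev.
  by rewrite -mulrA -/s; lra.
have {}alpha_gt : 9 / 20 * Dt < alpha.
  apply: le_lt_trans alpha_gt; rewrite ler_pM2r //.
  by rewrite ler_pdivlMr ?ltr0n //; lra.
have unit_mx tau : 0 < tau -> paraopt_mx L alpha sigma DT tau \in unitmx.
  by move=> tau_gt0; rewrite paraopt_mx_unit // (le_trans (ltW Dt_gt0)).
apply: paraopt_seq_cvg; try exact: unit_mx.
move=> z ev.
have := paraopt_eigenvalue_le alpha_gt0 sigma_lt0 dt_gt0 dt_le Dt_le ev.
rewrite -mulrA -/s => /le_lt_trans; apply.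
(* 3/4 * 14/15 + 3/10 = 1 *)
suff : Dt / (alpha + s) < 14 / 15 by lra.
rewrite ltr_pdivrMr //.
have s_gt : 2 / 3 * Dt < s.
  have : (2 / 3 * Dt) ^+ 2 < s ^+ 2.
    rewrite /s sqr_sqrtr; last by rewrite mulr_ge0 // ltW.
    have := ltr_pM2r Dt_gt0 (9 / 20 * Dt) alpha; rewrite alpha_gt => h.
    apply: le_lt_trans h; have := sqr_ge0 Dt; lra.
  by rewrite ltr_sqr // nnegrE mulr_ge0 // ltW.
lra.
Qed.
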